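(* 1. For any $w\in\tilde W$ the element $(\phi\circ j)^{-1}(t_w)\in\mathcal H$ has the form $\sum_{x\in\tilde W} a_{w,x}C'_x$, where $a_{w,x}$ is a polynomial in $q^{-1/2}$. Moreover, $(-1)^{\ell(x)}a_{w,x}$ has nonpositive integer coefficients. 2. For any $w\in\tilde W$ the element $(\phi\circ j)^{-1}(t_w)\in\mathcal H$ has the form $\sum_{x\in\tilde W} b_{w,x}T_x$, where $(q+1)b_{w,x}$ is a polynomial in $q^{-1/2}$.
   Context: $\tilde W=\langle s_0,s_1\mid s_0^2=s_1^2=1\rangle$ is the affine Weyl group of $\mathrm{SL}_2$ (the infinite dihedral group), with length function $\ell$, strong Bruhat order $\le$ and identity $1$. Let $q^{1/2}$ be an indeterminate and $\mathcal A=\mathbb Z[q^{1/2},q^{-1/2}]$. $H$ is the Iwahori–Hecke algebra: the $\mathcal A$-algebra with $\mathcal A$-basis $\{T_w\}_{w\in\tilde W}$ and relations $T_wT_{w'}=T_{ww'}$ if $\ell(ww')=\ell(w)+\ell(w')$, and $(T_s+1)(T_s-q)=0$ for $s\in\{s_0,s_1\}$. The Kazhdan–Lusztig bases (all Kazhdan–Lusztig polynomials equal $1$ here) are $$C_w=\sum_{y\le w}(-1)^{\ell(w)-\ell(y)}q^{\frac{\ell(w)-\ell(y)}{2}}q^{-\frac{\ell(y)}{2}}T_y,\qquad C'_w=q^{-\frac{\ell(w)}{2}}\sum_{y\le w}T_y.$$ Let $\overline{(\,\cdot\,)}$ be the involution of $\mathcal A$ with $\overline{q^{1/2}}=q^{-1/2}$.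 The ring involution $j$ of $H$ is $j(\sum a_wT_w)=\sum\overline{a_w}(-1)^{\ell(w)}q^{-\ell(w)}T_w$; it satisfies $C'_w=(-1)^{\ell(w)}j(C_w)$. Define $h_{x,y,z}\in\mathcal A$ by $C_xC_y=\sum_z h_{x,y,z}C_z$. The set of distinguished involutions is $\mathcal D=\{1,s_0,s_1\}$, and Lusztig's $a$-function has values $a(1)=0$ and $a(w)=1$ for $w\ne1$. $J$ is Lusztig's asymptotic Hecke algebra, a $\mathbb Z$-algebra with $\mathbb Z$-basis $\{t_w\}_{w\in\tilde W}$, and $\phi\colon H\to J\otimes_{\mathbb Z}\mathcal A$ is the $\mathcal A$-algebra map with $$\phi(C_x)=\sum_{\substack{z\in\tilde W,\ d\in\mathcal D\\ a(d)=a(z)}}h_{x,d,z}\,t_z.$$ Completions: $\mathcal H_C$ is the set of formal sums $\sum_x b_xC_x$ with $b_x\in\mathbb Z((q^{1/2}))$ such that for every $N>0$ one has $b_x\in q^{N/2}\mathbb Z[[q^{1/2}]]$ for $\ell(x)$ sufficiently large; $\mathcal J$ is defined in the same way with $t_x$ in place of $C_x$. The map $\phi$ extends (coefficientwise) to an isomorphism $\phi\colon\mathcal H_C\to\mathcal J$. $\mathcal H$ is the set of formal sums $\sum_x b_xC'_x$ with $b_x\in\mathbb Z((q^{-1/2}))$ satisfying the same condition with $q^{-1/2}$ in place of $q^{1/2}$. The involution $j$ extends to mutually inverse bijections between $\mathcal H$ and $\mathcal H_C$, with $j(\sum b_xC'_x)=\sum(-1)^{\ell(x)}\overline{b_x}C_x$.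 Thus $(\phi\circ j)^{-1}(t_w)=j(\phi^{-1}(t_w))\in\mathcal H$. An element $\sum_y a_yC'_y\in\mathcal H$ is written in the $T$-basis by expanding each $C'_y$; the coefficient of $T_x$ is the convergent series $\sum_{y\ge x}a_yq^{-\ell(y)/2}\in\mathbb Z((q^{-1/2}))$.
   Formalization: The sign claim is stated only for w≠1, since (-1)^{ℓ(x)}a_{1,x}=q^{-ℓ(x)/2} is positive for every x; the claim on (q+1)b_{w,x} excludes only w=x=1, where (q+1)b_{1,1}=q-1 is not a polynomial in q^{-1/2}. *)

(* Defs.v *)
From HB Require Import structures.
From mathcomp Require Import all_boot all_order all_algebra.
From mathcomp Require Import finmap monalg.
From mathcomp Require Import boolp classical_sets functions cardinality fsbigop.

Set Implicit Arguments.
Unset Strict Implicit.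
Unset Printing Implicit Defensive.

Import GRing.Theory Order.TTheory Num.Theory.
Local Open Scope classical_set_scope.
Local Open Scope ring_scope.

(* An element of the infinite dihedral group is its unique reduced word: a word in the two letters
   [false] (for s_0) and [true] (for s_1) without two equal adjacent letters.
   [dih_presentation] is the universal property of the presentation
   < s_0, s_1 | s_0^2 = s_1^2 = 1 >. *)

Definition reduced (s : seq bool) : bool := sorted [rel a b | a != b] s.

Record dih : predArgType := Dih { word :> seq bool; _ : reduced word }.
HB.instance Definition _ := [isSub for word].
HB.instance Definition _ := [Countable of dih by <:].

Definition lmul (b : bool) (s : seq bool) : seq bool :=
  if s is c :: s' then if b == c then s' else b :: s else [:: b].

Fact lmul_reduced b s : reduced s -> reduced (lmul b s).
Proof.
case: s => [|c s] //= h; case: eqP => [_|/eqP bc] /=; last by rewrite bc.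
exact: path_sorted h.
Qed.

Fact lmulK b s : reduced s -> lmul b (lmul b s) = s.
Proof.
case: s => [|c s] //=; first by rewrite eqxx.
case: (b =P c) => [->|/eqP bc] h /=; last by rewrite eqxx.
by case: s h => [|d s] //= /andP[/negbTE -> _].
Qed.

Definition wmul (s t : seq bool) : seq bool := foldr lmul t s.

Fact wmul_reduced s t : reduced t -> reduced (wmul s t).
Proof. by move=> rt; elim: s => //= b s; apply: lmul_reduced. Qed.

Fact wmul_lmul b s t : reduced s -> reduced t ->
  wmul (lmul b s) t = lmul b (wmul s t).
Proof.
case: s => [|c s] //= rs rt; case: eqP => [->|] //=.
by rewrite lmulK //; apply: wmul_reduced.
Qed.

Fact rev_reduced s : reduced s -> reduced (rev s).
Proof.
by rewrite /reduced rev_sorted; apply: sub_sorted => a b /=; rewrite eq_sym.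
Qed.

Fact wmul_rev s : wmul (rev s) s = [::].
Proof.
suff H t u : wmul (rev t) (t ++ u) = u by rewrite -{2}(cats0 s) H.
by elim: t => //= b t IH; rewrite rev_cons /wmul foldr_rcons /= eqxx.
Qed.

Fact wmul0 s : reduced s -> wmul s [::] = s.
Proof.
elim: s => [|b s IH] // rs; have := IH (path_sorted rs) => /= ->.
by case: s rs {IH} => [|c s] //= /andP[/negbTE ->].
Qed.

Definition dih_one : dih := @Dih [::] isT.
Definition dih_mul (x y : dih) : dih := Dih (wmul_reduced x (valP y)).
Definition dih_inv (x : dih) : dih := Dih (rev_reduced (valP x)).

Fact dih_mulA : associative dih_mul.
Proof.
move=> [x rx] [y ry] [z rz]; apply: val_inj => /=.
elim: x {rx} => //= b x IH; rewrite IH wmul_lmul //; exact: wmul_reduced.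
Qed.
Fact dih_mul1 : left_id dih_one dih_mul.
Proof. by move=> x; apply: val_inj. Qed.
Fact dih_mulr1 : right_id dih_one dih_mul.
Proof. by move=> x; apply: val_inj; apply: wmul0; apply: valP. Qed.
Fact dih_mulV : left_inverse dih_one dih_inv dih_mul.
Proof. by move=> x; apply: val_inj; apply: wmul_rev. Qed.
Fact dih_mulrV : right_inverse dih_one dih_inv dih_mul.
Proof. by move=> x; apply: val_inj; rewrite /= -{1}(revK x); apply: wmul_rev. Qed.

HB.instance Definition _ :=
  isGroup.Build dih dih_mulA dih_mul1 dih_mulr1 dih_mulV dih_mulrV.

Definition gen (b : bool) : dih := @Dih [:: b] isT.
Notation s0 := (gen false).
Notation s1 := (gen true).

Lemma gen_invol b : (gen b * gen b)%g = 1%g.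
Proof. by apply: val_inj; rewrite /= eqxx. Qed.

Lemma word_gen b (w : dih) : word (gen b * w)%g = lmul b w.
Proof. by []. Qed.

Lemma dih_ind (P : dih -> Prop) : P 1%g ->
  (forall b w, reduced (b :: word w) -> P w -> P (gen b * w)%g) ->
  forall w, P w.
Proof.
move=> P1 PM [s]; elim: s => [|b s IH] rs.
  by have -> : Dih rs = 1%g by apply: val_inj.
have rs' := path_sorted rs.
have -> : Dih rs = (gen b * Dih rs')%g.
  apply: val_inj => /=; case: s rs {IH rs'} => //= c s /andP[/negbTE -> //].
by apply: PM => //; apply: IH.
Qed.

Lemma dih_presentation (G : groupType) (g : bool -> G) :
  (forall b, g b * g b = 1)%g ->
  exists! f : dih -> G,
    (forall x y, f (x * y) = f x * f y)%g /\ (forall b, f (gen b) = g b).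
Proof.
move=> gg; pose F (s : seq bool) := foldr (fun b z => g b * z)%g 1%g s.
have Fl b s : reduced s -> F (lmul b s) = (g b * F s)%g.
  by case: s => [|c s] //= _; case: eqP => [->|] //=; rewrite mulgA gg mul1g.
exists (fun w : dih => F w); split; first split.
- move=> [x rx] [y ry] /=; elim: x {rx} => [|b x IH] /=; first by rewrite mul1g.
  by rewrite Fl ?IH ?mulgA //; apply: wmul_reduced.
- by move=> b; rewrite /= mulg1.
move=> f [fM fg]; apply: funext; elim/dih_ind => [|b w rw IH].
  apply/esym/(mulgI (f 1%g)); rewrite mulg1 -fM mul1g //.
by rewrite word_gen Fl ?(valP w) // IH fM fg.
Qed.

Definition len (w : dih) : nat := size w.

Lemma len_min (w : dih) (s : seq bool) :
  w = (\prod_(b <- s) gen b)%g -> (len w <= size s)%N.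
Proof.
move=> ->; elim: s => [|b s IH]; first by rewrite big_nil.
rewrite big_cons /len word_gen; set t := word _ in IH *.
apply: (@leq_trans (size t).+1) => //.
by case: t {IH} => //= c t; case: eqP => //= _; rewrite -addn2 leq_addr.
Qed.

(* Subword form of the strong Bruhat order. *)
Definition bruhat (y w : dih) : bool := subseq y w.

Lemma finite_bruhat (w : dih) : finite_set [set y | bruhat y w].
Proof.
pose S := [seq mask (val m) w | m : (size w).-tuple bool].
apply: (@sub_finite_set _ _ [set` pmap (insub : _ -> option dih) S]).
  move=> y /= /subseqP[m sm ym].
  rewrite mem_pmap_sub /=; apply/mapP.
  by exists (Tuple (introT eqP sm)); rewrite ?mem_enum.
exact: finite_seq.
Qed.
(* Z[q^{1/2}, q^{-1/2}]: finitely supported functions from [int] to [int], the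
   value at [k] being the coefficient of q^{k/2}. *)

Definition laurent : Type := {malg int[int]}.
HB.instance Definition _ := Choice.on laurent.

Definition qh (k : int) : laurent := << 1 *g k >>.

Definition lau_mul (p r : {malg int[int]}) : {malg int[int]} :=
  \sum_(i <- msupp p) \sum_(j <- msupp r) << p@_i * r@_j *g i + j >>.

Section LaurentRing.
Implicit Types p r s : {malg int[int]}.

Fact lau_mulw (d e : {fset int}) p r : (msupp p `<=` d)%fset ->
  (msupp r `<=` e)%fset ->
  lau_mul p r = \sum_(i <- d) \sum_(j <- e) << p@_i * r@_j *g i + j >>.
Proof.
move=> pd re; rewrite /lau_mul (big_fset_incl _ pd) /=.
  apply/eq_bigr=> i _; apply/big_fset_incl => // k _ /mcoeff_outdom ->.
  by rewrite mulr0 monalgU0.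
move=> k _ /mcoeff_outdom pk; rewrite big1 // => j _.
by rewrite pk mul0r monalgU0.
Qed.

Fact lau_mulC : commutative lau_mul.
Proof.
move=> p r; rewrite /lau_mul exchange_big; apply: eq_bigr => i _.
by apply: eq_bigr => j _; rewrite mulrC addrC.
Qed.

Fact lau_mulDl : left_distributive lau_mul +%R.
Proof.
move=> p r s.
rewrite (lau_mulw (msuppD_le p r) (fsubset_refl _)).
rewrite (lau_mulw (fsubsetUl (msupp p) (msupp r)) (fsubset_refl _)).
rewrite (lau_mulw (fsubsetUr (msupp p) (msupp r)) (fsubset_refl _)).
rewrite -big_split /=; apply/eq_bigr=> i _.
rewrite -big_split /=; apply/eq_bigr=> j _.
by rewrite mcoeffD mulrDl monalgUD.
Qed.

Fact lau_mul0 p : lau_mul 0 p = 0.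
Proof. by rewrite /lau_mul msupp0 big_seq_fset0. Qed.

Fact lau_mulDr : right_distributive lau_mul +%R.
Proof. by move=> p r s; rewrite !(lau_mulC p) lau_mulDl. Qed.

Fact lau_mulUU a b i j :
  lau_mul << a *g i >> << b *g j >> = << a * b *g i + j >>.
Proof.
rewrite (lau_mulw (@msuppU_le _ _ _ _) (@msuppU_le _ _ _ _)).
by rewrite !big_seq_fset1 !mcoeffUU.
Qed.

Fact lau_mul_suml I (t : seq I) (F : I -> {malg int[int]}) p :
  lau_mul (\sum_(i <- t) F i) p = \sum_(i <- t) lau_mul (F i) p.
Proof.
exact: (big_morph (lau_mul^~ p) (fun x y => lau_mulDl x y p) (lau_mul0 p)).
Qed.

Fact lau_mul_sumr I (t : seq I) (F : I -> {malg int[int]}) p :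
  lau_mul p (\sum_(i <- t) F i) = \sum_(i <- t) lau_mul p (F i).
Proof.
by rewrite lau_mulC lau_mul_suml; apply: eq_bigr => i _; rewrite lau_mulC.
Qed.

Fact lau_mulA : associative lau_mul.
Proof.
have UA i j k a b c : lau_mul << a *g i >> (lau_mul << b *g j >> << c *g k >>) =
    lau_mul (lau_mul << a *g i >> << b *g j >>) << c *g k >>.
  by rewrite !lau_mulUU mulrA addrA.
move=> p r s; rewrite [p]monalgE [LHS]lau_mul_suml.
rewrite [X in _ = lau_mul X s]lau_mul_suml [RHS]lau_mul_suml.
apply: eq_bigr => i _; rewrite [r]monalgE.
rewrite [X in lau_mul _ X = _]lau_mul_suml [LHS]lau_mul_sumr.
rewrite [X in _ = lau_mul X s]lau_mul_sumr [RHS]lau_mul_suml.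
apply: eq_bigr => j _; rewrite [s]monalgE.
rewrite [X in lau_mul _ X = _]lau_mul_sumr [LHS]lau_mul_sumr [RHS]lau_mul_sumr.
by apply: eq_bigr => k _; apply: UA.
Qed.

Fact lau_mul1 : left_id (qh 0) lau_mul.
Proof.
move=> p; rewrite [p]monalgE lau_mul_sumr; apply: eq_bigr => i _.
by rewrite lau_mulUU mul1r add0r.
Qed.

End LaurentRing.

(* The ring operations are sealed only to keep unification cheap. *)
HB.lock Definition lau0 : laurent := (0 : {malg int[int]}).
HB.lock Definition lau1 : laurent := qh 0.
HB.lock Definition lau_opp (p : laurent) : laurent := - (p : {malg int[int]}).
HB.lock Definition lau_add (p r : laurent) : laurent :=
  (p : {malg int[int]}) + (r : {malg int[int]}).
HB.lock Definition lau_mult (p r : laurent) : laurent := lau_mul p r.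

Section LaurentInstance.
Fact laD_A : associative lau_add.
Proof. by move=> p r s; rewrite lau_add.unlock addrA. Qed.
Fact laD_C : commutative lau_add.
Proof. by move=> p r; rewrite lau_add.unlock addrC. Qed.
Fact laD_0 : left_id lau0 lau_add.
Proof. by move=> p; rewrite lau_add.unlock lau0.unlock add0r. Qed.
Fact laD_N : left_inverse lau0 lau_opp lau_add.
Proof.
by move=> p; rewrite lau_add.unlock lau0.unlock lau_opp.unlock addNr.
Qed.
HB.instance Definition _ := GRing.isZmodule.Build laurent laD_A laD_C laD_0 laD_N.

Fact laM_A : associative lau_mult.
Proof. by move=> p r s; rewrite lau_mult.unlock lau_mulA. Qed.
Fact laM_C : commutative lau_mult.
Proof. by move=> p r; rewrite lau_mult.unlock lau_mulC. Qed.
Fact laM_1 : left_id lau1 lau_mult.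
Proof. by move=> p; rewrite lau_mult.unlock lau1.unlock lau_mul1. Qed.
Fact laM_Dl : left_distributive lau_mult +%R.
Proof.
move=> p r s; rewrite -[+%R]/lau_add lau_mult.unlock lau_add.unlock.
exact: lau_mulDl.
Qed.
Fact la1_neq0 : lau1 != 0.
Proof.
rewrite -[0]/lau0 lau1.unlock lau0.unlock.
by apply/eqP/malgP => /(_ 0) /eqP; rewrite mcoeffUU mcoeff0.
Qed.
HB.instance Definition _ := GRing.Zmodule_isComNzRing.Build laurent
  laM_A laM_C laM_1 laM_Dl la1_neq0.
End LaurentInstance.

Lemma lauP (p r : laurent) : (forall k, p@_k = r@_k) <-> p = r.
Proof. exact: malgP. Qed.
Lemma lau_coef0 k : (0 : laurent)@_k = 0.
Proof. by rewrite -[0]/lau0 lau0.unlock mcoeff0. Qed.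
Lemma lau_coefN k (p : laurent) : (- p)@_k = - p@_k.
Proof. by rewrite -[- p]/(lau_opp p) lau_opp.unlock mcoeffN. Qed.
Lemma lau_coefD k (p r : laurent) : (p + r)@_k = p@_k + r@_k.
Proof. by rewrite -[p + r]/(lau_add p r) lau_add.unlock mcoeffD. Qed.
Lemma lau_coef_qh k l : (qh l)@_k = (l == k)%:R.
Proof. by rewrite mcoeffU. Qed.
Lemma lau_mulE (p r : laurent) : p * r = lau_mul p r.
Proof. by rewrite -[p * r]/(lau_mult p r) lau_mult.unlock. Qed.
Lemma qh0 : qh 0 = 1.
Proof. by rewrite -[1]/lau1 lau1.unlock. Qed.
Lemma qhD i j : qh (i + j) = qh i * qh j.
Proof. by rewrite lau_mulE lau_mulUU mul1r. Qed.

Definition q : laurent := qh 2.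
(* The Iwahori-Hecke algebra: the free module on [dih], where [Tgen_act b] is
   left multiplication by T_{s_b} and T_w acts as the composite of the letters
   of its reduced word.  The defining relations are [T_mul] and [T_quad]. *)

Definition hecke : Type := {malg laurent[dih]}.
HB.instance Definition _ := Choice.on hecke.

(* As above, the operations are sealed only to keep unification cheap. *)
HB.lock Definition hec0 : hecke := (0 : {malg laurent[dih]}).
HB.lock Definition hec_opp (x : hecke) : hecke := - (x : {malg laurent[dih]}).
HB.lock Definition hec_add (x y : hecke) : hecke :=
  (x : {malg laurent[dih]}) + (y : {malg laurent[dih]}).
HB.lock Definition hec_scale (c : laurent) (x : hecke) : hecke :=
  c *: (x : {malg laurent[dih]}).

Section HeckeModule.
Fact hecD_A : associative hec_add.
Proof. by move=> x y z; rewrite hec_add.unlock addrA. Qed.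
Fact hecD_C : commutative hec_add.
Proof. by move=> x y; rewrite hec_add.unlock addrC. Qed.
Fact hecD_0 : left_id hec0 hec_add.
Proof. by move=> x; rewrite hec_add.unlock hec0.unlock add0r. Qed.
Fact hecD_N : left_inverse hec0 hec_opp hec_add.
Proof.
by move=> x; rewrite hec_add.unlock hec0.unlock hec_opp.unlock addNr.
Qed.
HB.instance Definition _ :=
  GRing.isZmodule.Build hecke hecD_A hecD_C hecD_0 hecD_N.

Fact hecZ_A c d x : hec_scale c (hec_scale d x) = hec_scale (c * d) x.
Proof. by rewrite hec_scale.unlock scalerA. Qed.
Fact hecZ_1 : left_id 1 hec_scale.
Proof. by move=> x; rewrite hec_scale.unlock scale1r. Qed.
Fact hecZ_Dr : right_distributive hec_scale +%R.
Proof.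
move=> c x y; rewrite -[+%R]/hec_add hec_scale.unlock hec_add.unlock.
exact: scalerDr.
Qed.
Fact hecZ_Dl x : {morph hec_scale^~ x : c d / c + d}.
Proof.
move=> c d; rewrite -[RHS]/(hec_add _ _) hec_scale.unlock hec_add.unlock.
exact: scalerDl.
Qed.
HB.instance Definition _ :=
  GRing.Zmodule_isLmodule.Build laurent hecke hecZ_A hecZ_1 hecZ_Dr hecZ_Dl.
End HeckeModule.

(* The coefficient of T_w in [x] is [x@_w]. *)
Lemma heckeP (x y : hecke) : (forall w, x@_w = y@_w) <-> x = y.
Proof. exact: malgP. Qed.
Lemma hec_coef0 w : (0 : hecke)@_w = 0.
Proof. by rewrite -[0]/hec0 hec0.unlock mcoeff0. Qed.
Lemma hec_coefN w (x : hecke) : (- x)@_w = - x@_w.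
Proof. by rewrite -[- x]/(hec_opp x) hec_opp.unlock mcoeffN. Qed.
Lemma hec_coefD w (x y : hecke) : (x + y)@_w = x@_w + y@_w.
Proof. by rewrite -[x + y]/(hec_add x y) hec_add.unlock mcoeffD. Qed.
Lemma hec_coefZ w c (x : hecke) : (c *: x)@_w = c * x@_w.
Proof. by rewrite -[c *: x]/(hec_scale c x) hec_scale.unlock mcoeffZ. Qed.
Lemma hec_coef_sum w I (s : seq I) (P : pred I) (F : I -> hecke) :
  (\sum_(i <- s | P i) F i)@_w = \sum_(i <- s | P i) (F i)@_w.
Proof.
apply: (big_morph (fun x : hecke => x@_w) (fun x y => hec_coefD w x y)).
exact: hec_coef0.
Qed.

Definition T (w : dih) : hecke := << 1 *g w >>.

Definition linext (V : lmodType laurent) (F : dih -> V) (x : hecke) : V :=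
  \sum_(w <- msupp x) x@_w *: F w.

Definition Tgen_act (b : bool) : hecke -> hecke :=
  linext (fun w => if (len w < len (gen b * w)%g)%N then T (gen b * w)%g
                   else q *: T (gen b * w)%g + (q - 1) *: T w).

Definition hecke_mul (x y : hecke) : hecke :=
  linext (fun w => foldr Tgen_act y (word w)) x.

Section Linext.
Variables (V : lmodType laurent) (F : dih -> V).

Fact linextw (d : {fset dih}) (x : hecke) : (msupp x `<=` d)%fset ->
  linext F x = \sum_(w <- d) x@_w *: F w.
Proof.
move=> xd; apply: (big_fset_incl _ xd) => w _ /mcoeff_outdom ->.
by rewrite scale0r.
Qed.

Fact linext_is_linear : linear (linext F).
Proof.
move=> a x y; pose d := (msupp x `|` msupp y)%fset.
have xd : (msupp x `<=` d)%fset by apply: fsubsetUl.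
have yd : (msupp y `<=` d)%fset by apply: fsubsetUr.
have sd : (msupp (a *: x + y) `<=` d)%fset.
  apply/fsubsetP => w; rewrite inE -!mcoeff_neq0 hec_coefD hec_coefZ.
  apply: contra_neqT; rewrite negb_or !negbK => /andP[/eqP-> /eqP->].
  by rewrite mulr0 addr0.
rewrite (linextw sd) (linextw xd) (linextw yd) scaler_sumr -big_split /=.
by apply: eq_bigr => w _; rewrite hec_coefD hec_coefZ scalerDl scalerA.
Qed.

HB.instance Definition _ :=
  GRing.isLinear.Build laurent hecke V *:%R (linext F) linext_is_linear.

Fact linextT w : linext F (T w) = F w.
Proof.
rewrite (@linextw [fset w]%fset) ?msuppU_le // big_seq_fset1.
by rewrite mcoeffUU scale1r.
Qed.
End Linext.

Lemma hec_coefT k w : (T w)@_k = (w == k)%:R.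
Proof. by rewrite mcoeffU. Qed.

Lemma heckeE (x : hecke) : x = \sum_(w <- msupp x) x@_w *: T w.
Proof.
apply/heckeP => k; rewrite hec_coef_sum.
have [kx|kx] := boolP (k \in msupp x); last first.
  rewrite mcoeff_outdom // big_seq big1 // => w wx.
  rewrite hec_coefZ hec_coefT; case: eqP => [wk|]; last by rewrite mulr0.
  by rewrite wk (negbTE kx) in wx.
rewrite (big_fsetD1 k) //= hec_coefZ hec_coefT eqxx mulr1 big_seq big1 ?addr0 //.
move=> w; rewrite !inE hec_coefZ hec_coefT => /andP[/negbTE -> _].
exact: mulr0.
Qed.

Lemma eq_linear (V : lmodType laurent) (f g : hecke -> V) :
  linear f -> linear g -> (forall w, f (T w) = g (T w)) -> f =1 g.
Proof.
move=> lf lg fg x.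
pose hf := GRing.isLinear.Build _ _ _ _ f lf.
pose hg := GRing.isLinear.Build _ _ _ _ g lg.
pose f' : {linear hecke -> V} := HB.pack f hf.
pose g' : {linear hecke -> V} := HB.pack g hg.
rewrite -[f x]/(f' x) -[g x]/(g' x) [x]heckeE !linear_sum.
by apply: eq_bigr => w _; rewrite !linearZ /= fg.
Qed.

Fact linear_comb (V W : lmodType laurent) (f g : V -> W) (c d : laurent) :
  linear f -> linear g -> linear (fun x => c *: f x + d *: g x).
Proof.
move=> lf lg a x y; rewrite lf lg 3!scalerDr !scalerA !(mulrC a).
by rewrite addrACA.
Qed.

Section HeckeRing.
Implicit Types x y z : hecke.

HB.instance Definition _ b := GRing.Linear.on (Tgen_act b).

Fact Tgen_actT b w : Tgen_act b (T w) =
  if (len w < len (gen b * w)%g)%N then T (gen b * w)%g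
  else q *: T (gen b * w)%g + (q - 1) *: T w.
Proof. exact: linextT. Qed.

Fact Tgen_actZ b c x : Tgen_act b (c *: x) = c *: Tgen_act b x.
Proof. exact: linearZ. Qed.

Fact Tgen_actD b x y : Tgen_act b (x + y) = Tgen_act b x + Tgen_act b y.
Proof. exact: linearD. Qed.

Fact len_gen b (w : dih) :
  (len w < len (gen b * w)%g)%N = (ohead (word w) != Some b).
Proof.
rewrite /len word_gen; case: (word w) => [|c s] //=.
rewrite (inj_eq Some_inj); case: (b =P c) => [->|/eqP bc] /=.
  by rewrite eqxx ltnNge leqnSn.
by rewrite ltnSn [c == b]eq_sym bc.
Qed.

Fact Tgen_act_quad b x :
  Tgen_act b (Tgen_act b x) = q *: x + (q - 1) *: Tgen_act b x.
Proof.
move: x; apply: eq_linear => [a x y|a x y|w].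
- by rewrite !linearP.
- by apply: (@linear_comb _ _ id (Tgen_act b)) => // c u v; apply: linearP.
have bbw : (gen b * (gen b * w))%g = w by rewrite mulgA gen_invol mul1g.
rewrite Tgen_actT; case: ifP => lw.
  by rewrite Tgen_actT bbw ltnNge (ltnW lw) /=.
rewrite Tgen_actD.
rewrite Tgen_actZ.
rewrite Tgen_actZ.
rewrite Tgen_actT.
rewrite bbw.
rewrite Tgen_actT.
rewrite lw.
suff -> : (len (gen b * w)%g < len w)%N by [].
move: lw; rewrite len_gen /len word_gen; case: (word w) => [|c s] //=.
by move/negbFE/eqP=> [->]; rewrite eqxx ltnSn.
Qed.

Fact hecke_mulT w y : hecke_mul (T w) y = foldr Tgen_act y (word w).
Proof. exact: linextT. Qed.

Fact hecke_mul_gen b y : hecke_mul (T (gen b)) y = Tgen_act b y.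
Proof. by rewrite hecke_mulT. Qed.

Fact hecke_mul_linl y : linear (hecke_mul^~ y).
Proof. by move=> a x z; apply: linearP. Qed.

Fact hecke_mulZl c x y : hecke_mul (c *: x) y = c *: hecke_mul x y.
Proof. exact: linearZ. Qed.

Fact hecke_mulDl : left_distributive hecke_mul +%R.
Proof. by move=> x y z; apply: linearD. Qed.

Fact hecke_mul_linr x : linear (hecke_mul x).
Proof.
move=> a y z; have H s : foldr Tgen_act (a *: y + z) s =
    a *: foldr Tgen_act y s + foldr Tgen_act z s.
  by elim: s => //= b s ->; rewrite linearP.
rewrite /hecke_mul /linext scaler_sumr -big_split /=; apply: eq_bigr => w _.
by rewrite H scalerDr !scalerA mulrC.
Qed.

Fact word_cons_gen b w : reduced (b :: word w) -> word (gen b * w)%g = b :: word w.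
Proof. by rewrite word_gen; case: (word w) => //= c s /andP[/negbTE ->]. Qed.

Fact hecke_mul_act b y z :
  hecke_mul (Tgen_act b y) z = Tgen_act b (hecke_mul y z).
Proof.
move: y; apply: eq_linear => [a x y|a x y|w].
- by rewrite Tgen_actD Tgen_actZ hecke_mulDl hecke_mulZl.
- by rewrite hecke_mulDl hecke_mulZl Tgen_actD Tgen_actZ.
rewrite Tgen_actT len_gen; case: ifPn => hw.
  rewrite !hecke_mulT word_cons_gen //.
  by case: w hw => -[|c s] //= h; rewrite (inj_eq Some_inj) eq_sym => -> /=.
have ww : word w = b :: word (gen b * w)%g.
  rewrite word_gen; case: (word w) hw => [|c s] //= /negPn/eqP[->].
  by rewrite eqxx.
rewrite hecke_mulDl 2!hecke_mulZl.
rewrite !hecke_mulT; move: (word _) ww => s ->.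
by rewrite /= Tgen_act_quad.
Qed.

Fact hecke_mulA : associative hecke_mul.
Proof.
move=> x y z; move: x; apply: eq_linear => [a x x'|a x x'|w].
- by rewrite hecke_mulDl hecke_mulZl.
- by rewrite !hecke_mulDl !hecke_mulZl.
rewrite !hecke_mulT; elim: (word w) => //= b s ->.
by rewrite hecke_mul_act.
Qed.

Fact hecke_mul1 : left_id (T 1%g) hecke_mul.
Proof. by move=> y; rewrite hecke_mulT. Qed.

Fact hecke_mulr1 : right_id (T 1%g) hecke_mul.
Proof.
move=> x; move: x; apply: eq_linear => [a x y|a x y|w] //.
  by rewrite hecke_mulDl hecke_mulZl.
rewrite hecke_mulT; elim/dih_ind: w => // b w rw IH.
rewrite word_cons_gen //= IH Tgen_actT /len (word_cons_gen rw) /=.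
by rewrite leqnn.
Qed.

Fact hecke_mulDr : right_distributive hecke_mul +%R.
Proof.
by move=> x y z; have := hecke_mul_linr x 1 y z; rewrite !scale1r.
Qed.

Fact hecke_1_neq0 : T 1%g != 0.
Proof.
by apply/eqP/heckeP => /(_ 1%g) /eqP; rewrite hec_coefT eqxx hec_coef0 oner_eq0.
Qed.

End HeckeRing.

HB.lock Definition hec1 : hecke := T 1%g.
HB.lock Definition hec_mult (x y : hecke) : hecke := hecke_mul x y.

Section HeckeInstance.
Implicit Types x y z : hecke.

Fact hecM_A : associative hec_mult.
Proof. by rewrite hec_mult.unlock; apply: hecke_mulA. Qed.
Fact hecM_1 : left_id hec1 hec_mult.
Proof. by rewrite hec_mult.unlock hec1.unlock; apply: hecke_mul1. Qed.
Fact hecM_r1 : right_id hec1 hec_mult.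
Proof. by rewrite hec_mult.unlock hec1.unlock; apply: hecke_mulr1. Qed.
Fact hecM_Dl : left_distributive hec_mult +%R.
Proof. by rewrite hec_mult.unlock; apply: hecke_mulDl. Qed.
Fact hecM_Dr : right_distributive hec_mult +%R.
Proof. by rewrite hec_mult.unlock; apply: hecke_mulDr. Qed.
Fact hec1_neq0 : hec1 != 0.
Proof. by rewrite hec1.unlock; apply: hecke_1_neq0. Qed.

HB.instance Definition _ := GRing.Zmodule_isNzRing.Build hecke
  hecM_A hecM_1 hecM_r1 hecM_Dl hecM_Dr hec1_neq0.

Fact hecke_mulE x y : x * y = hecke_mul x y.
Proof. by rewrite -[x * y]/(hec_mult x y) hec_mult.unlock. Qed.

Fact hecke_scaleAl (c : laurent) x y : c *: (x * y) = (c *: x) * y.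
Proof. by rewrite !hecke_mulE hecke_mulZl. Qed.

Fact hecke_scaleAr (c : laurent) x y : c *: (x * y) = x * (c *: y).
Proof.
have L0 : hecke_mul x 0 = 0 by rewrite -hecke_mulE mulr0.
by have := hecke_mul_linr x c y 0; rewrite L0 !addr0 !hecke_mulE => ->.
Qed.

HB.instance Definition _ := GRing.Lmodule_isLalgebra.Build laurent hecke
  hecke_scaleAl.
HB.instance Definition _ := GRing.Lalgebra_isAlgebra.Build laurent hecke
  hecke_scaleAr.
End HeckeInstance.

Lemma T1 : T 1%g = 1.
Proof. by rewrite -[1]/hec1 hec1.unlock. Qed.

Lemma Tgen_mul b (x : hecke) : T (gen b) * x = Tgen_act b x.
Proof. by rewrite hecke_mulE hecke_mul_gen. Qed.

Lemma T_mul (w w' : dih) :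
  len (w * w')%g = (len w + len w')%N -> T w * T w' = T (w * w')%g.
Proof.
elim/dih_ind: w => [|b w rw IH] h; first by rewrite !mul1g T1 mul1r.
have lbw : len (gen b * w)%g = (len w).+1 by rewrite /len word_cons_gen.
have lg v : (len (gen b * v)%g <= (len v).+1)%N.
  rewrite /len word_gen; case: (word v) => //= c s; case: eqP => _ //=.
  by rewrite leqW // leqW.
have lM v v' : (len (v * v')%g <= len v + len v')%N.
  elim/dih_ind: v => [|c v rv IHv]; first by rewrite mul1g.
  have -> : len (gen c * v)%g = (len v).+1 by rewrite /len word_cons_gen.
  rewrite -mulgA addSn; apply: leq_trans (_ : (len (v * v')%g).+1 <= _)%N => //.
  rewrite /len word_gen; case: (word (v * v')%g) => //= d s; case: eqP => _ //=.
  by rewrite leqW // leqW.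
have hw : len (w * w')%g = (len w + len w')%N.
  apply/eqP; rewrite eqn_leq lM /= -ltnS -addSn -lbw -h -mulgA; exact: lg.
have -> : T (gen b * w)%g = T (gen b) * T w.
  by rewrite Tgen_mul Tgen_actT lbw leqnn.
rewrite -mulrA IH // Tgen_mul Tgen_actT mulgA h lbw hw addSn.
by rewrite leqnn.
Qed.

Lemma T_quad b : (T (gen b) + 1) * (T (gen b) - q *: 1) = 0.
Proof.
have E (V : zmodType) (a c d : V) : a + (c - d) - c + (d - a) = 0.
  by rewrite [c - d]addrC [a + _]addrA addrK addrA subrK subrr.
have TT : T (gen b) * T (gen b) = q *: 1 + (q - 1) *: T (gen b).
  rewrite -{2 3}[T (gen b)]mulr1 2!Tgen_mul Tgen_act_quad.
  by rewrite -[Tgen_act b 1]Tgen_mul mulr1.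
rewrite mulrDl mul1r mulrBr TT -scalerAr mulr1 scalerBl scale1r.
exact: E.
Qed.
Definition C (w : dih) : hecke :=
  \sum_(y \in [set y | bruhat y w])
    ((-1) ^+ (len w - len y) * qh ((len w)%:Z - (len y)%:Z)
       * qh (- (len y)%:Z)) *: T y.

Definition C' (w : dih) : hecke :=
  qh (- (len w)%:Z) *: \sum_(y \in [set y | bruhat y w]) T y.

Lemma hec_coef_fsum (A : set dih) (c : dih -> laurent) k : finite_set A ->
  (\sum_(y \in A) c y *: T y)@_k = if k \in A then c k else 0.
Proof.
move=> fA; rewrite fsbig_finite //= hec_coef_sum.
have -> : (k \in A) = (k \in fset_set A) by rewrite in_fset_set.
case: ifPn => kA.
  rewrite (big_fsetD1 k) //= hec_coefZ hec_coefT eqxx mulr1 big_seq big1 ?addr0 //.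
  by move=> w; rewrite !inE hec_coefZ hec_coefT => /andP[/negbTE -> _]; apply: mulr0.
rewrite big_seq big1 // => w wA; rewrite hec_coefZ hec_coefT.
by case: eqP => [wk|]; rewrite ?mulr0 // -wk wA in kA *.
Qed.

Lemma C_coef w k : (C w)@_k = if bruhat k w then
  (-1) ^+ (len w - len k) * qh ((len w)%:Z - (len k)%:Z) * qh (- (len k)%:Z)
  else 0.
Proof.
rewrite hec_coef_fsum; last exact: finite_bruhat.
by congr (if _ then _ else _); apply/idP/idP; rewrite inE.
Qed.

Lemma C'_coef w k : (C' w)@_k = if bruhat k w then qh (- (len w)%:Z) else 0.
Proof.
rewrite hec_coefZ; under eq_fsbigr do rewrite -[T _]scale1r.
rewrite (hec_coef_fsum (fun=> 1)); last exact: finite_bruhat.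
have -> : (k \in [set y | bruhat y w]) = bruhat k w by apply/idP/idP; rewrite inE.
by case: ifP; rewrite ?mulr1 ?mulr0.
Qed.

Lemma bruhat_len y w : bruhat y w -> y != w -> (len y < len w)%N.
Proof.
move=> yw; rewrite ltn_neqAle (size_subseq yw) andbT; apply: contraNneq => e.
by apply/eqP/val_inj/eqP; rewrite -(size_subseq_leqif yw); apply/eqP.
Qed.

Lemma bruhat_refl w : bruhat w w. Proof. exact: subseq_refl. Qed.

Lemma qhK i : qh i * qh (- i) = 1.
Proof. by rewrite -qhD subrr qh0. Qed.

Lemma C_coef_diag w : (C w)@_w = qh (- (len w)%:Z).
Proof. by rewrite C_coef bruhat_refl subnn subrr qh0 !mul1r. Qed.

Lemma C_span (u : hecke) : exists c : hecke, linext C c = u.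
Proof.
have PD x y : (exists c, linext C c = x) -> (exists c, linext C c = y) ->
    exists c, linext C c = x + y.
  by move=> [c <-] [d <-]; exists (c + d); rewrite linearD.
have PZ a x : (exists c, linext C c = x) -> exists c, linext C c = a *: x.
  by move=> [c <-]; exists (a *: c); rewrite linearZ.
have P0 : exists c, linext C c = 0 by exists 0; rewrite linear0.
suff PT n w : (len w < n)%N -> exists c, linext C c = T w.
  rewrite [u]heckeE; elim/big_ind: _ => // w _; apply: PZ.
  exact: (PT (len w).+1).
elim: n w => // n IH w wn.
have H (x : hecke) : (forall k, x@_k != 0 -> (len k < len w)%N) ->
    exists c, linext C c = x.
  move=> Hx; rewrite [x]heckeE big_seq; elim/big_ind: _ => // k kx; apply: PZ.
  apply: IH; have kw : (len k < len w)%N by apply: Hx; rewrite mcoeff_neq0.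
  exact: leq_trans kw wn.
have -> : T w = qh (len w)%:Z *: (C w + - (C w - qh (- (len w)%:Z) *: T w)).
  by rewrite opprB addrCA subrr addr0 scalerA qhK scale1r.
apply: (PZ); apply: (PD); first by exists (T w); rewrite linextT.
rewrite -scaleN1r; apply: (PZ); apply: H => k.
rewrite hec_coefD hec_coefN hec_coefZ hec_coefT.
have [->|wk] := eqVneq w k; first by rewrite C_coef_diag mulr1 subrr eqxx.
rewrite mulr0 subr0 C_coef; case: ifPn => [kw _|]; last by rewrite eqxx.
by apply: bruhat_len => //; rewrite eq_sym.
Qed.

Lemma C_free : injective (linext C).
Proof.
suff H n (c : hecke) : (forall k, c@_k != 0 -> (len k < n)%N) ->
    linext C c = 0 -> c = 0.
  move=> c d cd; apply/eqP; rewrite -subr_eq0; apply/eqP.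
  apply: (H (\max_(k <- msupp (c - d)) len k).+1).
    by move=> k; rewrite mcoeff_neq0 => kc; rewrite ltnS leq_bigmax_seq.
  by rewrite linearB /= cd subrr.
elim: n c => [|n IH] c cn c0.
  by apply/heckeP => k; rewrite hec_coef0; apply/eqP; apply: contraT => /cn.
apply: (IH c) => // k ck; rewrite ltnNge; apply/negP => nk; have := cn _ ck; rewrite ltnS => kn.
have kc : k \in msupp c by rewrite -mcoeff_neq0.
have := congr1 (fun x : hecke => x@_k) c0.
rewrite /linext hec_coef_sum hec_coef0 (big_fsetD1 k) //= hec_coefZ C_coef_diag.
rewrite big_seq big1 ?addr0 => [e|z].
  by move: ck; rewrite -[c@_k]mulr1 -(qhK (- (len k)%:Z)) mulrA e mul0r eqxx.
rewrite !inE hec_coefZ C_coef => /andP[zk zc]; case: ifP => kz; last exact: mulr0.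
have := bruhat_len kz; rewrite eq_sym => /(_ zk) lkz.
have := cn z; rewrite mcoeff_neq0 zc => /(_ isT); rewrite ltnS => zn.
by have := leq_ltn_trans nk (leq_trans lkz zn); rewrite ltnn.
Qed.

(* [(Ccoord u)@_z] is the coefficient of C_z in [u]. *)
Definition Ccoord (u : hecke) : {malg laurent[dih]} := sval (cid (C_span u)).

Lemma CcoordE (u : hecke) :
  u = \sum_(z <- msupp (Ccoord u)) (Ccoord u)@_z *: C z.
Proof. by rewrite -[LHS](svalP (cid (C_span u))). Qed.

Lemma CcoordK : cancel (linext C) Ccoord.
Proof. by move=> c; apply: C_free; rewrite {1}/linext -CcoordE. Qed.

Definition h (x y z : dih) : laurent := (Ccoord (C x * C y))@_z.

(* A formal power series in q^{1/2}, possibly infinite in both directions, is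
   the function [int -> int] of its coefficients, the value at [n] being the
   coefficient of q^{n/2}.  Both Z((q^{1/2})) and Z((q^{-1/2})) are submodules
   of this module over [laurent]; no product of two such series is needed. *)

Definition qseries : Type := int -> int.

Definition lau_act (p : laurent) (f : qseries) : qseries :=
  fun n => \sum_(k <- msupp p) p@_k * f (n - k).

Definition qbar (f : qseries) : qseries := fun n => f (- n).

Definition laurent_up (f : qseries) : Prop :=
  exists N : int, forall n, n < N -> f n = 0.
Definition laurent_down (f : qseries) : Prop :=
  exists N : int, forall n, N < n -> f n = 0.

(* Coefficients of a formal sum over [dih] in one of the symbols C_x, C'_x,
   t_x. *)
Definition formal : Type := dih -> qseries.

(* The condition defining both H_C and J. *)
Definition complete_up (b : formal) : Prop :=
  (forall x, laurent_up (b x)) /\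
  forall N : nat, (0 < N)%N ->
    exists L : nat, forall x, (L <= len x)%N ->
      forall n : int, n < N%:Z -> b x n = 0.

(* The condition defining H. *)
Definition complete_down (b : formal) : Prop :=
  (forall x, laurent_down (b x)) /\
  forall N : nat, (0 < N)%N ->
    exists L : nat, forall x, (L <= len x)%N ->
      forall n : int, - N%:Z < n -> b x n = 0.

(* j : H -> H_C, from C'-coefficients to C-coefficients. *)
Definition jmap (b : formal) : formal :=
  fun x n => (-1) ^+ len x * qbar (b x) n.

Lemma jmap_complete b : complete_down b <-> complete_up (jmap b).
Proof.
have E x n : (jmap b x n = 0) <-> (b x (- n) = 0).
  by rewrite /jmap /qbar; split=> [/eqP|->]; rewrite ?mulr0 // mulf_eq0 signr_eq0 => /eqP.
split=> -[b1 b2]; split=> [x|N N0].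
- have [N HN] := b1 x; exists (- N) => n nN; apply/E/HN.
  by rewrite ltrNr.
- have [L HL] := b2 N N0; exists L => x Lx n nN; apply/E/HL => //.
  by rewrite ltrN2.
- have [N HN] := b1 x; exists (- N) => n nN; rewrite -[n]opprK; apply/E/HN.
  by rewrite ltrNl.
- have [L HL] := b2 N N0; exists L => x Lx n nN; rewrite -[n]opprK.
  by apply/E/HL => //; rewrite ltrNl.
Qed.

Definition dinv : seq dih := [:: 1%g; s0; s1].
Definition afun (w : dih) : nat := if w == 1%g then 0 else 1.

(* The coefficient of t_z in phi(C_x). *)
Definition phi_coef (x z : dih) : laurent :=
  \sum_(d <- dinv | afun d == afun z) h x d z.

(* [\sum_(x \in A) F x] is 0 when [F] has infinite support on [A].  For [b] in
   H_C each of the sums below has finite support, so that this is the limit of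
   the finite partial sums. *)
Definition phi (b : formal) : formal :=
  fun z n => \sum_(x \in [set: dih]) lau_act (phi_coef x z) (b x) n.

Definition tbasis (w : dih) : formal :=
  fun x n => ((x == w) && (n == 0))%:R.

(* The coefficient of T_x in the formal sum of the [a y] C'_y; see
   [Tcoef_finite] for convergence and [TcoefE] for the closed form. *)
Definition Tcoef (a : formal) (x : dih) : qseries :=
  fun n => \sum_(y \in [set: dih]) lau_act (C' y)@_x (a y) n.

(* [p] evaluated at q^{-1/2}. *)
Definition poly_qinv (p : {poly int}) : qseries :=
  fun n => if n <= 0 then p`_`|n|%N else 0.

Lemma lau_act_qh k f n : lau_act (qh k) f n = f (n - k).
Proof. by rewrite /lau_act msuppU oner_eq0 big_seq_fset1 mcoeffUU mul1r. Qed.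

Lemma lau_act0 f n : lau_act 0 f n = 0.
Proof.
rewrite /lau_act big_seq big1 // => k _.
by rewrite lau_coef0 mul0r.
Qed.

Lemma lau_act_C' x y f n :
  lau_act (C' y)@_x f n = if bruhat x y then f (n + (len y)%:Z) else 0.
Proof.
by rewrite C'_coef; case: ifP => _; rewrite ?lau_act_qh ?opprK ?lau_act0.
Qed.

Lemma finite_len L : finite_set [set y : dih | (len y < L)%N].
Proof.
pose S := [seq tval t | n <- iota 0 L, t <- enum {: n.-tuple bool}].
apply: (@sub_finite_set _ _ [set` pmap (insub : _ -> option dih) S]).
  move=> y /= yL; rewrite mem_pmap_sub /=; apply/allpairsPdep.
  by exists (len y), (in_tuple y); rewrite mem_iota mem_enum.
exact: finite_seq.
Qed.

Lemma Tcoef_finite a x n : complete_down a ->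
  finite_set [set y | lau_act (C' y)@_x (a y) n != 0].
Proof.
move=> [_ a2]; have [L HL] := a2 `|n|.+1 isT.
apply: sub_finite_set (finite_len L) => y /=; rewrite lau_act_C'.
case: ifP; rewrite ?eqxx // => _; apply: contraR; rewrite -leqNgt => Ly.
apply/eqP/HL => //; rewrite -ltrBlDr -opprD; apply: lt_le_trans (_ : - `|n| <= _).
  by rewrite ltrN2 -abszE -PoszD ltz_nat leq_addr.
exact: lerNnormlW.
Qed.

Lemma TcoefE a x n :
  Tcoef a x n = \sum_(y \in [set y | bruhat x y]) a y (n + (len y)%:Z).
Proof.
rewrite /Tcoef; under eq_fsbigr do rewrite lau_act_C'.
rewrite [RHS]fsbig_mkcond; apply: eq_fsbigr => y _.
rewrite /patch.
have -> : (y \in [set y | bruhat x y]) = bruhat x y by apply/idP/idP; rewrite inE.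
by [].
Qed.
Lemma C1 : C 1%g = 1.
Proof.
have w1 : word 1%g = [::] by [].
rewrite -T1; apply/heckeP => k; rewrite C_coef hec_coefT /bruhat w1 subseq0.
have -> : (1%g == k) = (word k == [::]) by rewrite eq_sym -val_eqE.
case: eqP => //= k0.
by rewrite /len k0 subnn subrr qh0 !mul1r.
Qed.

Lemma phi_at1 b n : phi b 1%g n = b 1%g n.
Proof.
have E x : phi_coef x 1%g = (x == 1%g)%:R.
  rewrite /phi_coef /dinv !big_cons big_nil /= addr0.
  rewrite /h C1 mulr1 -[C x](linextT C) CcoordK; exact: hec_coefT.
rewrite /phi (fsbigTE [fset (1%g : dih)]%fset) => [|x].
  by rewrite big_seq_fset1 E eqxx -[true%:R]/1 -qh0 lau_act_qh subr0.
by rewrite inE E => /negbTE ->; rewrite lau_act0.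
Qed.

(* The coefficient of C'_1 in (phi o j)^{-1}(t_1) is 1: it is not nonpositive,
   so a sign statement for (phi o j)^{-1}(t_w) has to leave out w = 1. *)
Lemma tbasis1_coef1 (a : formal) :
  phi (jmap a) = tbasis 1%g -> a 1%g = poly_qinv 1.
Proof.
move=> /(congr1 (fun f : formal => f 1%g)) e; apply: funext => n.
have := congr1 (fun f : qseries => f (- n)) e; rewrite phi_at1 /jmap /qbar.
rewrite /tbasis eqxx oppr_eq0 opprK /= mul1r => ->; rewrite /poly_qinv coef1.
by rewrite absz_eq0; case: eqP => [->|]; rewrite ?lexx ?if_same.
Qed.

(* Main.v *)
Require Import Defs.
From mathcomp Require Import all_boot all_order all_algebra.
From mathcomp Require Import finmap monalg.
From mathcomp Require Import boolp classical_sets functions cardinality fsbigop.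
From mathcomp Require Import zify ring.
Import GRing.Theory Order.TTheory Num.Theory.
Local Open Scope ring_scope.

(** Write v for q^{1/2}.  The element w <> 1 of the dihedral group is an
    alternating word: it lies on one of two rays, according to its first
    letter, at the position given by its length.  Right multiplication by a
    generator moves along the ray, and C_x (C_{s_0} + C_{s_1}) expands into the
    two neighbours of x on its ray minus (v + v^-1) C_x ([C_mul_gens]).  Hence
    phi, read on a ray as a map of sequences n |-> b_n with b_0 the coefficient
    at the identity, is the second-order operator
      b_n  |->  b_{n-1} + b_{n+1} - (v + v^-1) b_n      (n >= 1)
    together with b_0 |-> b_0 ([phi_ray] and [phi_at1]).  On the coefficients
    of the powers of v this is the discrete wave equation
      b_{n-1}(k) + b_{n+1}(k) = b_n(k-1) + b_n(k+1).

    Its homogeneous solutions are spanned by v^n and v^-n.  The inverse image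
    of t_1 is therefore b_n = v^n on both rays, and that of the element t_w at
    position m of a ray is the Green function of that ray,
      b_n = - v^{max(n,m)} [min(n,m)],
      [r] = v^{r-1} + v^{r-3} + ... + v^{1-r},
    and 0 on the other ray ([tinv], [phi_tinv]).  This is visibly a polynomial
    in v with nonpositive coefficients, which is the first claim.  It is the
    only preimage: a difference of two preimages has b_0 = 0, so it is
    b_n = [n] b_1, whose order in v decreases by one at each step unless
    b_1 = 0, contrary to convergence ([ray_vanish], [phi_inj]).

    For the second claim, after exchanging v and v^-1 the coefficient of T_x is
    the sum over y >= x of (-v)^{l(y)} b_y.  Beyond position m both kinds of
    solution satisfy b_{n+1} = v b_n, so on each ray the series is eventually
    geometric with ratio -v^2, and 1 + v^2 turns it into a polynomial
    ([ray_cancel]).  As q + 1 becomes v^-2 (1 + v^2), what remains is that the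
    series is divisible by v^2; this holds since b_n is divisible by v for
    n >= 1, and fails only for the coefficient of T_1 when w = 1
    ([Tcoef_jtinv_small]). *)

(** * The two rays of alternating words *)

Fixpoint alt (c : bool) (n : nat) : seq bool :=
  if n is m.+1 then c :: alt (~~ c) m else [::].

Lemma alt_reduced c n : reduced (alt c n).
Proof.
case: n => //= n; elim: n c => //= n IH c; rewrite IH andbT; by case: c.
Qed.

(** The identity is the common origin [ray c 0] of both rays, so that
    statements about neighbours on a ray need no separate case for it. *)
Definition ray (c : bool) (n : nat) : dih := Dih (alt_reduced c n).

Lemma len_ray c n : len (ray c n) = n.
Proof. by rewrite /len /=; elim: n c => //= n IH c; rewrite IH. Qed.

Lemma ray0 c : ray c 0 = 1%g.
Proof. exact: val_inj. Qed.

Lemma dihP (P : dih -> Prop) :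
  P 1%g -> (forall c n, P (ray c n.+1)) -> forall x, P x.
Proof.
move=> P1 Pray [[|c s] rs].
  by rewrite (_ : Dih rs = 1%g) //; apply: val_inj.
suff e : c :: s = alt c (size s).+1.
  rewrite (_ : Dih rs = ray c (size s).+1); [exact: Pray|exact: val_inj].
elim: s c rs => //= d s IH c /andP[cd rs]; congr (_ :: _).
have <- : d = ~~ c by case: c d cd {rs} => [] [].
exact: IH.
Qed.

(** A word starting with the wrong letter embeds after skipping one letter, so
    the order compares lengths up to a shift by one between the rays. *)
Lemma bruhat_ray c n d m :
  bruhat (ray c n) (ray d m) = (n == 0%N) || (n + (c != d) <= m)%N.
Proof.
rewrite /bruhat /=; elim: m c n d => [|m IH] c [|n] d //=.
case: (eqVneq c d) => [->|cd].
  by rewrite IH eqxx /=; lia.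
rewrite -[c :: _]/(alt c n.+1) IH.
have -> : c != ~~ d = false by case: c d cd => [] [].
lia.
Qed.

Lemma ray_eq c n d m :
  (ray c n == ray d m) = (n == m) && ((n == 0%N) || (c == d)).
Proof.
apply/eqP/andP => [e|[/eqP<- /orP[/eqP->|/eqP->//]]]; last by rewrite !ray0.
have /eqP nm : n = m by rewrite -(len_ray c n) e len_ray.
split=> //; move/(congr1 val): e => /=.
by case: n m nm => [|n] [|m] //= _ [->].
Qed.

Lemma ray_neq1 c n : ray c n.+1 != 1%g.
Proof. by rewrite -(ray0 c) ray_eq. Qed.



Lemma gen_ray c : gen c = ray c 1.
Proof. exact: val_inj. Qed.

(** The letter of [alt c] at position n, counted from 0, is [c (+) odd n]. *)
Lemma ray_gen c n : (ray c n * gen (c (+) odd n))%g = ray c n.+1.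
Proof.
apply: val_inj; rewrite /=.
elim: n c => [|n IH] c /=; first by rewrite addbF.
have -> : c (+) ~~ odd n = ~~ c (+) odd n by case: c (odd n) => [] [].
by rewrite IH /=; case: c.
Qed.

(** * Right multiplication by the generators in the Hecke algebra *)

(** Only the sum of the two generators enters phi, and unlike a single
    generator it acts in the same way at all positions of both rays. *)
Definition Tgens : hecke := T s0 + T s1.

Lemma T_gen_sum c n : Tgens = T (gen (c (+) odd n.+1)) + T (gen (c (+) odd n)).
Proof. by rewrite /Tgens /=; case: c (odd n) => [] []//=; rewrite addrC. Qed.

Lemma T_gen_sq b : T (gen b) * T (gen b) = q *: 1 + (q - 1) *: T (gen b).
Proof.
have E (V : zmodType) (x y z t : V) : x - y + (z - t) = 0 -> x = t + (y - z).
  by move/eqP; rewrite addr_eq0 subr_eq opprB => /eqP ->; rewrite addrA addrAC.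
rewrite scalerBl scale1r; apply: E; rewrite -[RHS](T_quad b).
by rewrite mulrDl mul1r mulrBr -scalerAr mulr1.
Qed.

Lemma T_ray_gen c n : T (ray c n) * T (gen (c (+) odd n)) = T (ray c n.+1).
Proof. by rewrite T_mul ray_gen // !len_ray gen_ray len_ray addn1. Qed.

Lemma T_ray_sum c n :
  T (ray c n.+1) * Tgens =
    T (ray c n.+2) + (q *: T (ray c n) + (q - 1) *: T (ray c n.+1)).
Proof.
rewrite (T_gen_sum c n) mulrDr T_ray_gen; congr (_ + _).
rewrite -{1}T_ray_gen -mulrA T_gen_sq mulrDr -!scalerAr mulr1.
by rewrite T_ray_gen.
Qed.

(** Both sides are linear in [u], so that it is enough to take u = T_w. *)
Lemma mul_Tgens_coef_ray u c n : (u * Tgens)@_(ray c n.+1) =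
  u@_(ray c n) + (q - 1) * u@_(ray c n.+1) + q * u@_(ray c n.+2).
Proof.
pose f (u : hecke) : laurent^o := (u * Tgens)@_(ray c n.+1).
pose g (u : hecke) : laurent^o :=
  u@_(ray c n) + (q - 1) * u@_(ray c n.+1) + q * u@_(ray c n.+2).
rewrite -[LHS]/(f u) -[RHS]/(g u); apply: (@eq_linear laurent^o) => [a x y|a x y|w].
- by rewrite /f mulrDl -scalerAl hec_coefD hec_coefZ.
- by rewrite /g !hec_coefD !hec_coefZ -[a *: _]/(a * _); ring.
rewrite /f /g {f g}; elim/dihP: w => [|d m].
  rewrite {1}T1 mul1r /Tgens !hec_coefD !hec_coefT !gen_ray -!(ray0 c) !ray_eq /=.
  by case: n => [|n] //=; case: c => //=; rewrite ?mulr0 ?addr0 ?add0r.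
rewrite T_ray_sum !hec_coefD !hec_coefZ !hec_coefT !ray_eq !eqSS /=.
case: (eqVneq d c) => _; rewrite ?orbT ?andbT ?orbF ?andbF /=.
  by rewrite addrA addrAC.
by case: m => [|m]; rewrite /= ?andbF ?mulr0 ?addr0 ?add0r ?mulr0.
Qed.

Lemma mul_Tgens_coef1 u :
  (u * Tgens)@_(1%g : dih) = q * (u@_s0 + u@_s1).
Proof.
pose f (u : hecke) : laurent^o := (u * Tgens)@_(1%g : dih).
pose g (u : hecke) : laurent^o := q * (u@_s0 + u@_s1).
rewrite -[LHS]/(f u) -[RHS]/(g u); apply: (@eq_linear laurent^o) => [a x y|a x y|w].
- by rewrite /f mulrDl -scalerAl hec_coefD hec_coefZ.
- by rewrite /g !hec_coefD !hec_coefZ -[a *: _]/(a * _); ring.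
rewrite /f /g {f g}; elim/dihP: w => [|d m].
  rewrite {1}T1 mul1r /Tgens !hec_coefD !hec_coefT -(ray0 true) !gen_ray.
  by rewrite !ray_eq /= mulrDr !mulr0.
rewrite T_ray_sum !hec_coefD !hec_coefZ !hec_coefT -(ray0 d) !gen_ray !ray_eq /=.
by case: m => [|m]; rewrite ?mulr0 ?addr0 ?add0r //=;
  case: d; rewrite /= ?mulr0 ?addr0 ?add0r ?mulr0.
Qed.

(** The sign (-1)^(m + n) replaces (-1)^(m - n), which avoids the truncated
    subtraction. *)
Definition Ccoef (m n : nat) : laurent := (-1) ^+ (m + n) * qh (m%:Z - (n.*2)%:Z).

Lemma sign_double (R : pzRingType) k : (-1) ^+ (k + k) = 1 :> R.
Proof. by rewrite -signr_odd addnn odd_double. Qed.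

Lemma C_coef_ray c n d m : (C (ray d m))@_(ray c n) =
  if (n == 0%N) || (n + (c != d) <= m)%N then Ccoef m n else 0.
Proof.
rewrite C_coef bruhat_ray !len_ray; case: ifP => // h.
have nm : (n <= m)%N by case/orP: h => [/eqP->|] //; apply: leq_trans (leq_addr _ _).
rewrite /Ccoef -mulrA -qhD -[in RHS](subnK nm) -addnA exprD sign_double mulr1.
rewrite !(subnK nm); congr (_ * qh _).
by rewrite -addnn PoszD; ring.
Qed.

(** Up to sign, [Ccoef m n] is a power of v: multiplying by a power of v
    reaches every pair with the right exponent. *)
Lemma Ccoef_shift b m n m' n' k :
  odd (m + n + (m' + n')) = b ->
  m%:Z - (n.*2)%:Z + k = m'%:Z - (n'.*2)%:Z ->
  qh k * Ccoef m n = (-1) ^+ b * Ccoef m' n'.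
Proof.
move=> <- e; rewrite /Ccoef mulrCA -qhD addrC e signr_odd [in RHS]exprD -mulrA.
by congr (_ * _); rewrite mulrA -exprD sign_double mul1r.
Qed.

Lemma C_gen b : C (gen b) = qh (-1) *: T (gen b) - qh 1 *: 1.
Proof.
apply/heckeP => k; rewrite hec_coefD hec_coefN !hec_coefZ hec_coefT -T1 hec_coefT.
elim/dihP: k => [|c n].
  rewrite -(ray0 b) gen_ray C_coef_ray !ray_eq /= /Ccoef expr1 mulN1r subr0.
  by rewrite mulr0 mulr1 sub0r.
rewrite gen_ray C_coef_ray eq_sym ray_eq eq_sym -(ray0 c) ray_eq /= mulr0 subr0.
case: n => [|n]; last by rewrite mulr0.
by case: (eqVneq c b); rewrite //= ?mulr0 // mulr1 /Ccoef sign_double mul1r.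
Qed.

(** The bookkeeping of powers of v in [C_mul_gens], with p and r standing for
    v and v^-1, and a, u, b for the coefficients of C_x at three consecutive
    positions of a ray. *)
Fact absorb_inverse (R : comRingType) (p r a b u : R) : p * r = 1 ->
  r * (a + (p * p - 1) * u + p * p * b) - (p + p) * u =
  r * a + p * b - (p + r) * u.
Proof.
move=> pr; have -> : r * (a + (p * p - 1) * u + p * p * b) - (p + p) * u =
  r * a + p * b - (p + r) * u + p * (p * r - 1) * (u + b) by ring.
by rewrite pr subrr mulr0 mul0r addr0.
Qed.

Definition qnum2 : laurent := qh 1 + qh (-1).

(** One of the generators shortens x, and C_x is an eigenvector for it with
    eigenvalue -(v + v^-1); the other one lengthens x and yields the two
    neighbours.  The last term removes C_1, since the neighbour of a generator
    towards the origin is absent from the product. *)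
Lemma C_mul_gens d m : C (ray d m.+1) * (C s0 + C s1) =
  C (ray d m.+2) + C (ray d m) - qnum2 *: C (ray d m.+1) - (m == 0%N)%:R *: 1.
Proof.
have pr : qh 1 * qh (-1) = 1 by apply: qhK.
have qE : q = qh 1 * qh 1 by rewrite -qhD.
set u := C (ray d m.+1).
have -> : u * (C s0 + C s1) = qh (-1) *: (u * Tgens) - (qh 1 + qh 1) *: u.
  rewrite !C_gen /Tgens addrACA -scalerDr mulrDr -scalerAr; congr (_ + _).
  by rewrite -opprD -scalerDl mulrN -scalerAr mulr1.
apply/heckeP => k; rewrite !hec_coefD !hec_coefN !hec_coefZ -T1 hec_coefT.
elim/dihP: k => [|c n].
  rewrite mul_Tgens_coef1 eqxx mulr1 !gen_ray -!(ray0 d) !C_coef_ray /=.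
  (* At T_1 both rays contribute, through the coefficients at s_0 and s_1. *)
  have E1 : qh 1 * Ccoef m.+1 0 = (-1) ^+ true * Ccoef m.+2 0.
    by apply: Ccoef_shift; lia.
  have E2 : qh (-1) * Ccoef m.+1 0 = (-1) ^+ true * Ccoef m 0.
    by apply: Ccoef_shift; lia.
  have E3 : qh 1 * Ccoef m.+1 1 = (-1) ^+ false * Ccoef m 0.
    by apply: Ccoef_shift; lia.
  have -> X : qh (-1) * (q * X) = qh 1 * X.
    by rewrite qE !mulrA (mulrC (qh (-1))) pr mul1r.
  rewrite mulrDr /qnum2 !mulrDl E1 E2.
  rewrite 2!(fun_if (fun x => qh 1 * x)) E3 expr0 mul1r mulr0 expr1.
  case: m {u E1 E2 E3} => [|m].
    (* Only one of s_0 and s_1 lies below the generator x: this accounts for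
       the correction term. *)
    have -> : Ccoef 0 0 = 1 by rewrite /Ccoef mul1r qh0.
    by case: d => /=; ring.
  have le (b : bool) : (1 + b <= m.+2)%N by case: b.
  by rewrite !le subr0; ring.
rewrite mul_Tgens_coef_ray -(ray0 c) ray_eq /= mulr0 subr0 !C_coef_ray /=.
rewrite qE absorb_inverse //; congr (_ + _ - _).
  rewrite (fun_if (fun x => qh (-1) * x)) mulr0.
  rewrite (@Ccoef_shift false _ _ m.+2 n.+1) ?mul1r; try lia.
  congr (if _ then _ else _); lia.
rewrite (fun_if (fun x => qh 1 * x)) mulr0.
rewrite (@Ccoef_shift false _ _ m n.+1) ?mul1r; try lia.
by congr (if _ then _ else _); lia.
Qed.

(** * The map phi along a ray *)

Fact linext_Ccoord u : linext C (Ccoord u) = u.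
Proof. exact: esym (CcoordE u). Qed.

Fact CcoordD u v : Ccoord (u + v) = (Ccoord u : hecke) + Ccoord v.
Proof.
apply: C_free; rewrite linext_Ccoord.
by rewrite linearD /= !linext_Ccoord.
Qed.

(** For z <> 1 the distinguished involutions with the same a-value as z are the
    two generators. *)
Lemma phi_coefE x z : z != 1%g ->
  phi_coef x z = (Ccoord (C x * (C s0 + C s1)))@_z.
Proof.
move=> z1; rewrite /phi_coef /dinv !big_cons big_nil /afun (negbTE z1) eqxx.
have g1 b : (gen b == 1%g) = false by rewrite gen_ray (negbTE (ray_neq1 _ _)).
by rewrite !g1 /= addr0 /h mulrDr CcoordD hec_coefD.
Qed.

Lemma phi_coef_ray x c m : phi_coef x (ray c m.+1) =
  (x == ray c m)%:R + (x == ray c m.+2)%:R - qnum2 * (x == ray c m.+1)%:R.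
Proof.
rewrite phi_coefE ?ray_neq1 //; elim/dihP: x => [|d n].
  have -> : C 1%g * (C s0 + C s1) = linext C (T s0 + T s1).
    by rewrite C1 mul1r linearD /= !linextT.
  rewrite CcoordK hec_coefD !hec_coefT -(ray0 c) !gen_ray !ray_eq /=.
  by case: m c => [|m] []; rewrite /= ?mulr0 ?subr0 ?addr0 ?add0r.
have -> : C (ray d n.+1) * (C s0 + C s1) =
    linext C (T (ray d n.+2) + T (ray d n) - qnum2 *: T (ray d n.+1)
              - (n == 0%N)%:R *: T 1%g).
  by rewrite C_mul_gens !linearB !linearD !linearZ /= !linextT C1.
rewrite CcoordK !(hec_coefD, hec_coefN, hec_coefZ) !hec_coefT -(ray0 c) !ray_eq /=.
rewrite mulr0 subr0 !eqSS.
by case: n.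
Qed.

Fact lau_actw (d : {fset int}) p f n : (msupp p `<=` d)%fset ->
  lau_act p f n = \sum_(k <- d) p@_k * f (n - k).
Proof.
move=> pd; rewrite /lau_act (big_fset_incl _ pd) //= => k _ /mcoeff_outdom ->.
exact: mul0r.
Qed.

Lemma lau_actD p r f n : lau_act (p + r) f n = lau_act p f n + lau_act r f n.
Proof.
pose d := (msupp p `|` msupp r `|` msupp (p + r)%R)%fset.
rewrite !(@lau_actw d) ?/d -?fsetUA ?fsubsetUl //; last 2 first.
- by rewrite fsetUCA fsubsetUl.
- by rewrite fsetUA fsubsetUr.
by rewrite -big_split; apply: eq_bigr => k _; rewrite lau_coefD mulrDl.
Qed.

Lemma lau_actN p f n : lau_act (- p) f n = - lau_act p f n.
Proof.
apply/eqP; rewrite -addr_eq0 -lau_actD addNr; apply/eqP; exact: lau_act0.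
Qed.

(** This holds for every family [b], convergent or not, since only three terms
    of the sum defining phi are nonzero. *)
Lemma phi_ray b c m k : phi b (ray c m.+1) k =
  b (ray c m) k + b (ray c m.+2) k -
  (b (ray c m.+1) (k - 1) + b (ray c m.+1) (k + 1)).
Proof.
pose S := (ray c m |` (ray c m.+1 |` [fset ray c m.+2]))%fset.
rewrite /phi (fsbigTE S) => [|x]; last first.
  rewrite !inE !negb_or phi_coef_ray => /and3P[/negbTE-> /negbTE-> /negbTE->].
  by rewrite mulr0 subr0 addr0 lau_act0.
have eqE i j : (ray c i == ray c j) = (i == j) by rewrite ray_eq eqxx orbT andbT.
have [m01 m10] : (m == m.+1) = false /\ (m.+1 == m) = false by lia.
have [m02 m20] : (m == m.+2) = false /\ (m.+2 == m) = false by lia.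
rewrite /S !big_fsetU1 ?big_seq_fset1 /= ?inE ?eqE ?eqSS ?m01 ?m02 //.
rewrite !phi_coef_ray !eqE !eqSS !eqxx ?m01 ?m02 ?m10 ?m20.
rewrite !mulr0 mulr1 !subr0 !addr0 !add0r -[true%:R]/1 -qh0 !lau_act_qh subr0.
by rewrite lau_actN lau_actD !lau_act_qh opprK addrCA addrC.
Qed.


(** * The inverse image of a basis element *)

Definition slab (M : nat) (r : int) : bool :=
  [&& - M%:Z < r, r < M%:Z & odd (absz (r + M%:Z))].

(** The support of v^{max(n,M)} [min(n,M)] as a Laurent polynomial in v: its
    exponents run from |n-M|+1 to n+M-1 in steps of 2.  The coordinates k+n and
    k-n are those along which the wave equation transports data. *)
Definition cone (M n : nat) (k : int) : bool :=
  (M%:Z < k + n%:Z) && slab M (k - n%:Z).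

(** The indicator of the cone is a function of k-n restricted to k+n > M, so it
    solves the wave equation away from the edge k+n = M.  On that edge only the
    two ends of the interval for k-n contribute: one is the source, at position
    M and k = 0; the other falls on the origin of the ray. *)
Lemma cone_rec M n k :
  (cone M.+1 n k)%:R + (cone M.+1 n.+2 k)%:R
  - ((cone M.+1 n.+1 (k - 1))%:R + (cone M.+1 n.+1 (k + 1))%:R)
  = - ((n == M) && (k == 0))%:R :> int.
Proof.
rewrite /cone.
have -> : k - n.+2%:Z = k - n%:Z - 2 by lia.
have -> : k - 1 - n.+1%:Z = k - n%:Z - 2 by lia.
have -> : k + 1 - n.+1%:Z = k - n%:Z by lia.
have -> : k - 1 + n.+1%:Z = k + n%:Z by lia.
have -> : k + 1 + n.+1%:Z = k + n.+2%:Z by lia.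
have [far|off] := boolP (M.+1%:Z < k + n%:Z).
  have -> : M.+1%:Z < k + n.+2%:Z by lia.
  have -> : (n == M) && (k == 0) = false by lia.
  by rewrite /= [in X in _ - X]addrC subrr.
have [near|off2] := boolP (M.+1%:Z < k + n.+2%:Z); last first.
  by have -> : (n == M) && (k == 0) = false by lia.
rewrite /= !add0r; have [kn|kn] : k + n%:Z = M.+1%:Z \/ k + n%:Z = M%:Z by lia.
  (* The edge carries no point of the parity class. *)
  have -> : (n == M) && (k == 0) = false by lia.
  have even_edge r : ~~ odd (absz (r + M.+1%:Z)) -> slab M.+1 r = false.
    by rewrite /slab => /negbTE ->; rewrite !andbF.
  by rewrite !even_edge //; lia.
have edge j : slab M.+1 (M%:Z - (j.*2)%:Z) = (j <= M)%N.
  rewrite /slab; have -> : odd (absz (M%:Z - (j.*2)%:Z + M.+1%:Z)) by lia.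
  lia.
have -> : k - n%:Z - 2 = M%:Z - (n.+1.*2)%:Z by lia.
have -> : k - n%:Z = M%:Z - (n.*2)%:Z by lia.
have -> : (k == 0) = (n == M) by lia.
by rewrite !edge andbb; case: ltngtP.
Qed.

(** The C-coordinates of phi^{-1}(t_w). *)
Definition tinv (w : dih) : formal := fun x k =>
  if w == 1%g then (k == (len x)%:Z)%:R
  else - ((ohead x == ohead w) && cone (len w) (len x) k)%:R.

Lemma tinv1 x k : tinv 1%g x k = (k == (len x)%:Z)%:R.
Proof. by rewrite /tinv eqxx. Qed.

Lemma tinv_ray d M c n k : tinv (ray d M.+1) (ray c n) k =
  - ((c == d) && cone M.+1 n k)%:R.
Proof.
rewrite /tinv (negbTE (ray_neq1 _ _)) !len_ray; case: n => [|n] /=.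
  have -> : cone M.+1 0 k = false by rewrite /cone /slab; lia.
  by rewrite !andbF.
by rewrite (inj_eq Some_inj).
Qed.

Lemma phi_tinv w : phi (tinv w) = tbasis w.
Proof.
apply: funext => z; apply: funext => k; rewrite /tbasis.
elim/dihP: z => [|c n].
  rewrite phi_at1; elim/dihP: w => [|d M]; first by rewrite tinv1 eqxx.
  rewrite -(ray0 d) tinv_ray ray_eq eqxx /= /cone /slab.
  by rewrite (_ : [&& _, _, _ & _] = false) ?oppr0 //; lia.
rewrite phi_ray; elim/dihP: w => [|d M].
  rewrite !tinv1 !len_ray (negbTE (ray_neq1 _ _)) /=; lia.
rewrite !tinv_ray ray_eq eqSS /=; case: (c == d) => /=.
  by rewrite andbT -[RHS]opprK -(cone_rec M n k) !opprD !opprK.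
by rewrite andbF.
Qed.

Lemma tinv_lt0 w x (k : int) : k < 0 -> tinv w x k = 0.
Proof.
move=> k0; elim/dihP: w => [|d M]; first by rewrite tinv1; lia.
elim/dihP: x => [|c n]; rewrite -?(ray0 d) tinv_ray /cone /slab; lia.
Qed.

Lemma tinv_gt w x (k : int) : (len w + len x)%:Z < k -> tinv w x k = 0.
Proof.
elim/dihP: w => [|d M]; first by rewrite tinv1 /len /=; lia.
by elim/dihP: x => [|c n]; rewrite -?(ray0 d) !len_ray tinv_ray /cone /slab; lia.
Qed.

Lemma tinv_complete w : complete_up (tinv w).
Proof.
split=> [x|N _].
  by exists 0 => k; apply: tinv_lt0.
exists (N + len w)%N => x; elim/dihP: w => [|d M].
  move=> lx k kN; rewrite tinv1; case: eqP => // kx.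
  by move: lx kN; rewrite kx /len /=; lia.
have cone0 n k : (N + M.+1 <= n)%N -> k < N%:Z -> cone M.+1 n k = false.
  by rewrite /cone /slab; lia.
elim/dihP: x => [|c n]; rewrite -?(ray0 d) !len_ray => lx k kN;
  by rewrite tinv_ray cone0 // andbF.
Qed.

(** * Injectivity of phi *)

(** A homogeneous solution starting from 0 is d_n = [n] d_1.  If v^N is the
    lowest power of v in d_1, then d_n starts with the same coefficient at
    v^{N-n+1}, so it cannot tend to 0. *)
Lemma ray_vanish (d : nat -> int -> int) :
  (forall k, d 0%N k = 0) ->
  (forall n k, d n k + d n.+2 k = d n.+1 (k - 1) + d n.+1 (k + 1)) ->
  laurent_up (d 1%N) ->
  (exists L, forall n k, (L <= n)%N -> k < 1 -> d n k = 0) ->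
  forall n k, d n k = 0.
Proof.
move=> d0 rec [N0 HN0] [L HL].
(* Vanishing of d_1 below N spreads along the line k + n = N + 1. *)
have up N : (forall k, k < N -> d 1%N k = 0) ->
    forall n k, k + n%:Z < N + 1 -> d n k = 0.
  move=> HN; suff H n : (forall k, k + n%:Z < N + 1 -> d n k = 0) /\
      (forall k, k + n.+1%:Z < N + 1 -> d n.+1 k = 0) by move=> n; have [] := H n.
  elim: n => [|n [IH1 IH2]]; first by split=> k ?; [exact: d0|apply: HN; lia].
  split=> // k kn; have := rec n k.
  rewrite IH1 ?(IH2 (k - 1)) ?(IH2 (k + 1)) ?add0r //; lia.
have step N : (forall k, k < N -> d 1%N k = 0) -> d 1%N N = 0.
  (* On that line the recursion transports the coefficient of v^N in d_1. *)
  move=> HN; have diag n : d n.+1 (N - n%:Z) = d 1%N N.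
    elim: n => [|n IH]; first by rewrite subr0.
    have := rec n (N - n.+1%:Z).
    rewrite (up N HN n) ?(up N HN n.+1 (_ - 1)) ?add0r; try lia.
    by move=> ->; rewrite -IH; congr (d _ _); lia.
  rewrite -(diag (L + `|N|)%N); apply: HL; lia.
have d1 j : forall k, k < N0 + j%:Z -> d 1%N k = 0.
  elim: j => [|j IH] k kj; first by apply: HN0; lia.
  have [|->] : k < N0 + j%:Z \/ k = N0 + j%:Z by lia.
    exact: IH.
  exact: step.
move=> n k; apply: (up (k + n%:Z)); last by lia.
move=> i _; apply: (d1 (absz (i - N0 + 1))); lia.
Qed.

Lemma phi_inj b1 b2 : complete_up b1 -> complete_up b2 -> phi b1 = phi b2 ->
  b1 = b2.
Proof.
move=> [up1 dec1] [up2 dec2] e.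
have ez z k : phi b1 z k = phi b2 z k by rewrite e.
apply: funext => x; apply: funext => k; apply/eqP; rewrite -subr_eq0; apply/eqP.
suff H c : forall n k, b1 (ray c n) k - b2 (ray c n) k = 0.
  by elim/dihP: x => [|c n]; rewrite -?(ray0 true); apply: H.
apply: ray_vanish => [j|n j||].
- by rewrite !ray0 -(phi_at1 b1) -(phi_at1 b2) ez subrr.
- by have := ez (ray c n.+1) j; rewrite !phi_ray; lia.
- have [N1 H1] := up1 (ray c 1); have [N2 H2] := up2 (ray c 1).
  exists (Order.min N1 N2) => j; rewrite lt_min => /andP[j1 j2].
  by rewrite H1 ?H2 ?subrr.
have [L1 H1] := dec1 1%N isT; have [L2 H2] := dec2 1%N isT.
exists (maxn L1 L2) => n j; rewrite geq_max => /andP[l1 l2] j1.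
by rewrite H1 ?H2 ?subrr ?len_ray.
Qed.

(** * The element of the completed Hecke algebra *)

(** The C'-coordinates of (phi o j)^{-1}(t_w). *)
Definition jtinv (w : dih) : formal :=
  fun x n => (-1) ^+ len x * tinv w x (- n).

Lemma jmap_jtinv w : jmap (jtinv w) = tinv w.
Proof.
apply: funext => x; apply: funext => n.
by rewrite /jmap /qbar /jtinv opprK mulrA -exprD sign_double mul1r.
Qed.

Lemma jmap_inj : injective jmap.
Proof.
move=> f g e; apply: funext => x; apply: funext => n.
have := congr1 (fun h : formal => h x (- n)) e.
rewrite /jmap /qbar opprK => /(congr1 (fun i => (-1) ^+ len x * i)).
by rewrite !mulrA -exprD sign_double !mul1r.
Qed.

Lemma jtinv_unique w :
  unique (fun f : formal => complete_down f /\ phi (jmap f) = tbasis w) (jtinv w).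
Proof.
split=> [|f [cf pf]].
  by rewrite jmap_complete jmap_jtinv phi_tinv; split=> //; apply: tinv_complete.
apply/jmap_inj/phi_inj; rewrite ?jmap_jtinv ?phi_tinv //.
  exact: tinv_complete.
exact/jmap_complete.
Qed.

Lemma poly_qinvE (f : qseries) (K : nat) : (forall n, 0 < n -> f n = 0) ->
  (forall k : nat, (K <= k)%N -> f (- k%:Z) = 0) ->
  f = poly_qinv (\poly_(i < K) f (- i%:Z)).
Proof.
move=> f0 fK; apply: funext => n; rewrite /poly_qinv coef_poly.
case: ifPn => [n0|]; last by rewrite -ltNge; apply: f0.
have nE : n = - `|n|%N%:Z by lia.
by rewrite -nE; case: ifPn => //; rewrite -leqNgt => /fK; rewrite -nE.
Qed.

(** * Coefficients in the T-basis *)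

Lemma sum_dih (F : dih -> int) M :
  (forall y, (M < len y)%N -> F y = 0) ->
  \sum_(y \in [set: dih]%classic) F y = F 1%g +
    \sum_(c : bool) \sum_(1 <= i < M.+1) F (ray c i).
Proof.
move=> FM; pose r := 1%g :: [seq ray true i | i <- iota 1 M]
  ++ [seq ray false i | i <- iota 1 M].
have mem_r y : (len y <= M)%N -> y \in r.
  elim/dihP: y => [|c n]; rewrite ?mem_head // len_ray => nM.
  by rewrite in_cons mem_cat; case: c; rewrite map_f ?orbT // mem_iota; lia.
have ur : uniq r.
  rewrite /= cat_uniq !(map_inj_uniq (can_inj (len_ray _))) iota_uniq /= andbT.
  apply/andP; split.
    rewrite mem_cat negb_or; apply/andP.
    split; apply/mapP => -[i]; rewrite mem_iota => + /eqP;
      by rewrite -(ray0 true) ray_eq; lia.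
  apply/hasPn => y /mapP[i + ->]; rewrite mem_iota => i0.
  by apply/mapP => -[j _ /eqP]; rewrite ray_eq; lia.
rewrite big_bool addrA -(@fsbig_widen _ _ _ _ [set` r]%classic) //; last first.
  move=> y [_ /= yr]; apply: FM; rewrite ltnNge; apply/negP => yM.
  by apply: yr; apply: mem_r.
by rewrite -fsbig_seq // big_cons big_cat /= !big_map /= addrA /index_iota subn1.
Qed.

Lemma Tcoef_jtinvE w x k : Tcoef (jtinv w) x (- k) =
  \sum_(y \in [set: dih]%classic)
    (if bruhat x y then (-1) ^+ len y * tinv w y (k - (len y)%:Z) else 0).
Proof.
apply: eq_fsbigr => y _; rewrite lau_act_C' /jtinv.
by case: ifP => // _; congr (_ * tinv w y _); lia.
Qed.

(** Both sides are taken at the same difference of exponent and position, and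
    once the sum of these two exceeds l(w) the coefficient depends on nothing
    else but its parity. *)
Lemma tinv_ray_shift w c i (k : int) : (len w)%:Z < k ->
  tinv w (ray c i.+1) (k + 2 - i.+1%:Z) = tinv w (ray c i) (k - i%:Z).
Proof.
elim/dihP: w => [|d M]; rewrite ?tinv1 ?tinv_ray !len_ray => kw.
  by congr (_ %:R); lia.
by congr (- (_ && _)%:R); rewrite /cone /slab; lia.
Qed.

Lemma tinv_ray_small w c i (k : int) : (0 < i)%N -> k <= 1 ->
  tinv w (ray c i) (k - i%:Z) = 0.
Proof.
move=> i0 k1; elim/dihP: w => [|d M]; first by rewrite tinv1 len_ray; lia.
rewrite tinv_ray (_ : cone _ _ _ = false) ?andbF // /cone /slab; lia.
Qed.

Lemma tinv_ray_large w c i (k : int) : (len w)%:Z + (i.*2)%:Z < k ->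
  tinv w (ray c i) (k - i%:Z) = 0.
Proof.
elim/dihP: w => [|d M]; rewrite ?len_ray => kw; first by rewrite tinv1 len_ray; lia.
rewrite tinv_ray (_ : cone _ _ _ = false) ?andbF // /cone /slab; lia.
Qed.

(** This is the coefficient of v^{k+2} in the product of the series by 1 + v^2:
    term i times v^2 cancels term i + 1.  Terms near the boundary of the
    condition y >= x would spoil this, but they vanish for such large k. *)
Lemma ray_cancel w x c M (k : int) : (len w)%:Z + ((len x).+1.*2)%:Z < k ->
  let f i j := if bruhat x (ray c i)
    then (-1) ^+ i * tinv w (ray c i) (j - i%:Z) else 0 in
  \sum_(1 <= i < M.+2) f i (k + 2) + \sum_(1 <= i < M.+1) f i k = 0.
Proof.
move=> kwx f; rewrite big_ltn // big_add1 /= -addrA -big_split /=.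
rewrite {1}/f tinv_ray_large ?mulr0 ?if_same ?add0r; last by lia.
rewrite big_nat big1 // => i /andP[i0 _]; rewrite /f tinv_ray_shift ?exprS; last by lia.
have [ix|xi] := leqP i (len x).
  by rewrite tinv_ray_large ?mulr0 ?if_same //; lia.
have -> : bruhat x (ray c i) = true.
  elim/dihP: x xi {kwx f} => [|e n]; rewrite -?(ray0 c) len_ray bruhat_ray //; lia.
have -> : bruhat x (ray c i.+1) = true.
  elim/dihP: x xi {kwx f} => [|e n]; rewrite -?(ray0 c) len_ray bruhat_ray //; lia.
by rewrite mulN1r mulNr addNr.
Qed.

(** For y <> 1 the series b_y is divisible by v, hence v^{l(y)} b_y by v^2.  The
    term y = 1 is present only for x = 1, and it vanishes unless w = 1. *)
Lemma Tcoef_jtinv_small w x (k : int) : ~ (w = 1%g /\ x = 1%g) -> k <= 1 ->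
  Tcoef (jtinv w) x (- k) = 0.
Proof.
move=> wx k1; rewrite Tcoef_jtinvE fsbig1 // => y _; case: ifP => // xy.
apply/eqP; rewrite mulf_eq0; apply/orP; right; apply/eqP.
elim/dihP: y xy => [|c i] xy; last by rewrite len_ray tinv_ray_small.
have x1 : x = 1%g.
  by elim/dihP: x xy {wx} => // e n; rewrite -(ray0 e) bruhat_ray.
elim/dihP: w wx => [[]//|d M _].
rewrite -(ray0 d) len_ray tinv_ray (_ : cone _ _ _ = false) ?andbF // /cone /slab; lia.
Qed.

Lemma Tcoef_jtinv_large w x (k : int) : (len w)%:Z + ((len x).+1.*2)%:Z < k ->
  Tcoef (jtinv w) x (- (k + 2)) + Tcoef (jtinv w) x (- k) = 0.
Proof.
move=> kwx.
have k_nat : k = `|k|%N%:Z by lia.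
pose F j y := if bruhat x y then (-1) ^+ len y * tinv w y (j - (len y)%:Z) else 0.
(* Since b_y has no negative powers of v, degree j sees only l(y) <= j. *)
have F0 (j : int) (y : dih) : j < (len y)%:Z -> F j y = 0.
  by rewrite /F => jy; rewrite tinv_lt0 ?mulr0 ?if_same // subr_lt0.
have F1 j : k <= j -> F j 1%g = 0.
  rewrite /F => kj; case: ifP => // _.
  have := @tinv_ray_large w true 0 j; rewrite ray0 => -> //; rewrite ?mulr0 //; lia.
rewrite !Tcoef_jtinvE -/(F k) -/(F (k + 2)).
(* The sum in degree k + 2 is cut one term later, to match the shift of i. *)
rewrite (@sum_dih (F (k + 2)) `|k|.+2) => [|y ky]; last by apply: F0; lia.
rewrite (@sum_dih (F k) `|k|.+1) => [|y ky]; last by apply: F0; lia.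
rewrite !F1 ?add0r -?big_split /=; try lia.
apply: big1 => c _; apply: etrans (@ray_cancel w x c `|k|.+1 k kwx).
by congr (_ + _); apply: eq_bigr => i _; rewrite /F len_ray.
Qed.

Theorem theorem1 (w : dih) :
  exists a : formal,
    [/\ unique (fun f : formal => complete_down f /\ phi (jmap f) = tbasis w) a,
        forall x : dih, exists p : {poly int}, a x = poly_qinv p /\
          (w <> 1%g -> forall i : nat, (-1) ^+ len x * p`_i <= 0)
      & forall x : dih, ~ (w = 1%g /\ x = 1%g) -> exists p : {poly int},
          lau_act (q + 1) (Tcoef a x) = poly_qinv p].
Proof.
exists (jtinv w); split; first exact: jtinv_unique.
  move=> x; pose K := (len w + len x).+1; exists (\poly_(i < K) jtinv w x (- i%:Z)).
  split=> [|w1 i].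
    apply: poly_qinvE => [n n0|k kK]; rewrite /jtinv.
      by rewrite tinv_lt0 ?mulr0 // oppr_lt0.
    rewrite opprK tinv_gt ?mulr0 //; lia.
  rewrite coef_poly; case: ifP => // _; last by rewrite mulr0.
  rewrite /jtinv opprK mulrA -exprD sign_double mul1r /tinv.
  by rewrite (introF eqP w1) oppr_le0.
move=> x wx; pose K := ((len w) + (len x).+1.*2).+1.
exists (\poly_(i < K) lau_act (q + 1) (Tcoef (jtinv w) x) (- i%:Z)).
have actE n : lau_act (q + 1) (Tcoef (jtinv w) x) n =
    Tcoef (jtinv w) x (n - 2) + Tcoef (jtinv w) x n.
  by rewrite lau_actD -qh0 !lau_act_qh subr0.
apply: poly_qinvE => [n n0|k kK]; rewrite actE.
  rewrite -[n]opprK -opprD !Tcoef_jtinv_small ?addr0 //; lia.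
by rewrite -opprD Tcoef_jtinv_large //; lia.
Qed.
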